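(* Let $\mathbb{F}$ be a subfield of $\mathbb{C}$ and let $n$ be a positive integer. The set $$\Big\{\sum_{r_1,\dots,r_n=0}^{\infty}\binom{r_1+\cdots+r_n}{r_1,\dots,r_n}\Big[\prod_{i=1}^n(2r_i)!\binom{\ell_i}{2r_i}\Big]\,\xi_{1,r_1+\cdots+r_n}(t)\,x_1^{\ell_1-2r_1}\cdots x_n^{\ell_n-2r_n}\ \Big|\ \ell_1,\dots,\ell_n\in\mathbb{N}\Big\}$$ forms a basis of the space of polynomial solutions $u\in\mathbb{F}[t,x_1,\dots,x_n]$ of the linear wave equation with dissipation $$u_{tt}+u_t-u_{x_1x_1}-u_{x_2x_2}-\cdots-u_{x_nx_n}=0.$$
   Context: $\mathbb{N}$ is the set of nonnegative integers; $\binom{r_1+\cdots+r_n}{r_1,\dots,r_n}$ is the multinomial coefficient; $\binom{\ell}{k}=0$ when $k>\ell\geq 0$ (so such terms are zero). For a nonzero scalar $a$ and $i\in\mathbb{N}$, the polynomial $\xi_{a,i}(t)$ is defined by $\xi_{a,0}(t)=1$, $\xi_{a,1}(t)=\frac{t}{a}$, and for $i\ge 2$ $$\xi_{a,i}(t)=\frac{t^i}{i!\,a^i}-\frac{t^{i-1}}{(i-2)!\,a^{i+1}}+\sum_{r=2}^{i-1}\frac{(-1)^r\prod_{s=1}^{r-1}(i+s)}{(i-r-1)!\,r!\,a^{r+i}}\,t^{i-r}.$$ Here it is used with $a=1$. *)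

(* Defs.v *)
From HB Require Import structures.
From mathcomp Require Import all_boot all_order all_algebra.
From mathcomp Require Import boolp classical_sets reals complex.
From mathcomp Require Import ssrcomplements mpoly.

Set Implicit Arguments.
Unset Strict Implicit.
Unset Printing Implicit Defensive.

Import GRing.Theory.

Local Open Scope ring_scope.
Local Open Scope classical_set_scope.

Section Bases.
Variables (K : fieldType) (V : lmodType K).

Definition lin_indep (B : set V) : Prop :=
  forall (s : seq V) (c : V -> K),
    uniq s -> (forall v, v \in s -> B v) ->
    \sum_(v <- s) c v *: v = 0 -> forall v, v \in s -> c v = 0.

Definition lin_span (B : set V) : set V :=
  [set u | exists (s : seq V) (c : V -> K),
      (forall v, v \in s -> B v) /\ u = \sum_(v <- s) c v *: v].

(* Hamel basis of the (possibly infinite dimensional) subspace W. *)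
Definition is_basis (W B : set V) : Prop :=
  [/\ B `<=` W, lin_indep B & W `<=` lin_span B].

End Bases.

(* The polynomial xi_{a,i}, evaluated at an element t of a K-algebra;
   a is meant to be nonzero. *)
Definition xi (K : fieldType) (A : algType K) (a : K) (i : nat) (t : A) : A :=
  match i with
  | 0 => 1
  | 1 => a^-1 *: t
  | _ =>
      (i`!%:R * a ^+ i)^-1 *: t ^+ i
      - ((i - 2)`!%:R * a ^+ i.+1)^-1 *: t ^+ i.-1
      + \sum_(2 <= r < i)
          ((-1) ^+ r * (\prod_(1 <= s < r) (i + s)%N)%:R
             / ((i - r - 1)`!%:R * r`!%:R * a ^+ (r + i))) *: t ^+ (i - r)
  end.

Definition multinomial (n : nat) (r : 'X_{1..n}) : nat :=
  (\sum_(i < n) r i)`! %/ \prod_(i < n) (r i)`!.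

(* In {mpoly K[n.+1]}, variable 0 is the time t and variable i.+1 is x_(i.+1)
   for i < n. *)
Section Wave.
Variables (K : fieldType) (n : nat).
Notation P := {mpoly K[n.+1]}.

Definition tvar : 'I_n.+1 := ord0.
Definition xvar (i : 'I_n) : 'I_n.+1 := lift ord0 i.

Definition dissipative_wave_solutions : set P :=
  [set u | u^`M(tvar)^`M(tvar) + u^`M(tvar)
           - \sum_(i < n) u^`M(xvar i)^`M(xvar i) = 0].

Definition wave_term (l r : 'X_{1..n}) : P :=
  (multinomial r * \prod_(i < n) ((2 * r i)`! * 'C(l i, 2 * r i)))%:R
  *: (xi 1 (\sum_(i < n) r i) ('X_tvar : P)
      * \prod_(i < n) 'X_(xvar i) ^+ (l i - 2 * r i)).

(* The sum over all r in N^n: by wave_term_eq0 and wave_polE below, cutting it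
   off at total degree \sum_i l i drops only zero terms. *)
Definition wave_pol (l : 'X_{1..n}) : P :=
  \sum_(r : 'X_{1..n < (mdeg l).+1}) wave_term l r.

Lemma wave_term_eq0 (l r : 'X_{1..n}) (i : 'I_n) :
  (l i < 2 * r i)%N -> wave_term l r = 0.
Proof.
by move=> lt_lr; rewrite /wave_term (bigD1 i) //= bin_small // muln0 mul0n
  muln0 scale0r.
Qed.

Lemma wave_polE (l : 'X_{1..n}) (N : nat) : (mdeg l < N)%N ->
  wave_pol l = \sum_(r : 'X_{1..n < N}) wave_term l r.
Proof.
move=> lt_lN; rewrite /wave_pol.
rewrite (big_sub_widen 'X_{1..n < (mdeg l).+1} 'X_{1..n < N} xpredT
  (wave_term l)) /= => [|r]; last by rewrite ltnS => /leq_ltn_trans; apply.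
rewrite big_mkcond /=; apply: eq_bigr => r _; case: ltnP => // lt_lr.
have [i lt_i|le_rl] := pickP (fun i : 'I_n => l i < 2 * r i)%N.
  by rewrite (wave_term_eq0 lt_i).
move: lt_lr; rewrite ltnNge !mdegE leq_sum // => i _.
by rewrite (leq_trans (leq_pmull _ (isT : 0 < 2)%N)) // leqNgt le_rl.
Qed.

End Wave.

(* Main.v *)
(* The polynomials xi_k = xi_(1,k) satisfy xi_(k+1)'' + xi_(k+1)' = xi_k, and the
   proposed basis element is sum_k xi_k(t) Delta^k x^l, with Delta^k expanded by
   the multinomial theorem; shifting k shows that it solves the equation, and it
   restricts to x^l at t = 0 because xi_k(0) = 0 for k > 0.  Conversely, although
   the equation has second order in t, a polynomial solution is determined by its
   restriction to t = 0: on polynomials in t, the kernel of d^2 + d consists of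
   the constants.  Hence restriction to t = 0 is an isomorphism from the solution
   space onto F[x], carrying the proposed basis to the monomials. *)

Require Import Defs.
From HB Require Import structures.
From mathcomp Require Import all_boot all_order all_algebra.
From mathcomp Require Import boolp classical_sets reals complex.
From mathcomp Require Import mpoly.
From mathcomp Require Import ring zify.

Set Implicit Arguments.
Unset Strict Implicit.
Unset Printing Implicit Defensive.

Import GRing.Theory.

Local Open Scope ring_scope.
Local Open Scope classical_set_scope.

(** * Multinomial coefficients and bounded multi-indices *)

Lemma dvdn_prod_fact (I : Type) (s : seq I) (f : I -> nat) :
  (\prod_(i <- s) (f i)`! %| (\sum_(i <- s) f i)`!)%N.
Proof.
elim: s => [|i s IHs]; first by rewrite !big_nil.
rewrite !big_cons -(bin_fact (leq_addr (\sum_(j <- s) f j) (f i))).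
by rewrite addKn dvdn_mull // dvdn_mul.
Qed.

Lemma prod_mnm_subU_fact (n : nat) (r : 'X_{1..n}) (i : 'I_n) : (r i != 0)%N ->
  (r i * \prod_(j < n) ((r - U_(i))%MM j)`! = \prod_(j < n) (r j)`!)%N.
Proof.
move=> ri0; rewrite (bigD1 i) //= [RHS](bigD1 i) //= mulnA; congr (_ * _)%N.
  rewrite mnmBE mnm1E eqxx subn1.
  by case: (r i) ri0 => // k _; rewrite factS.
apply: eq_bigr => j ji; rewrite mnmBE mnm1E.
by rewrite eq_sym (negPf ji) subn0.
Qed.

Lemma mdeg_subU (n : nat) (r : 'X_{1..n}) (i : 'I_n) : (r i != 0)%N ->
  mdeg r = (mdeg (r - U_(i))).+1.
Proof.
by move=> ri0; rewrite -[in LHS](@submK _ U_(i) r) ?lep1mP // mdegD mdeg1 addn1.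
Qed.

Lemma multinomial_prod_fact (n : nat) (r : 'X_{1..n}) :
  (multinomial r * \prod_(i < n) (r i)`! = (mdeg r)`!)%N.
Proof. by rewrite /multinomial mdegE divnK // dvdn_prod_fact. Qed.

(** After multiplication by the product of the r_i!, the i-th summand becomes r_i (|r| - 1)!, and
    these add up to |r|!. Indices with r_i = 0 are left out because truncated subtraction would
    return r itself. *)
Lemma multinomial_pascal (n : nat) (r : 'X_{1..n}) : r != 0%MM ->
  multinomial r = (\sum_(i < n | (r i != 0)%N) multinomial (r - U_(i))%MM)%N.
Proof.
move=> r0; have P0 : (0 < \prod_(i < n) (r i)`!)%N.
  by apply/prodn_gt0 => i; apply: fact_gt0.
apply/eqP; rewrite -(eqn_pmul2r P0) multinomial_prod_fact big_distrl /=.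
under eq_bigr => i ri0.
  rewrite -(prod_mnm_subU_fact ri0) mulnCA multinomial_prod_fact.
  rewrite -[mdeg _]/(mdeg _).+1.-1 -(mdeg_subU ri0).
  over.
rewrite -big_distrl /=.
have -> : (\sum_(i < n | (r i != 0)%N) r i = mdeg r)%N.
  rewrite mdegE [RHS](bigID (fun i => (r i != 0)%N)) /=.
  rewrite [X in (_ = _ + X)%N]big1 ?addn0 //.
  by move=> i; rewrite negbK => /eqP.
by move: r0; rewrite -mdeg_eq0; case: (mdeg r) => // k _; rewrite factS.
Qed.

Lemma big_bmnm_shift (V : nmodType) (n N : nat) (i : 'I_n) (G : 'X_{1..n} -> V) :
  \sum_(r : 'X_{1..n < N.+1} | (r i != 0)%N) G (r - U_(i))%MM
    = \sum_(r : 'X_{1..n < N}) G r.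
Proof.
have up (r : 'X_{1..n < N}) : (mdeg (r + U_(i)) < N.+1)%N.
  by rewrite mdegD mdeg1 addn1 ltnS bmdeg.
have dn (r : 'X_{1..n < N.+1}) : (r i != 0)%N -> (mdeg (r - U_(i)) < N)%N.
  by move=> ri0; rewrite -ltnS -mdeg_subU // bmdeg.
(* For N = 0 both sums are empty; otherwise [bm0] inhabits the bounded type and can serve as the
   default of [insubd], which is never returned on the indices summed. *)
case: N up dn => [|N] up dn.
  rewrite [RHS]big1 => [|[r //]]; rewrite big_pred0 // => r.
  by apply/negbTE/negP => ri0; have := dn r ri0; rewrite ltn0.
rewrite (reindex_onto (fun r => BMultinom (up r))
                      (fun r => insubd (bm0 : 'X_{1..n < N.+1}) (r - U_(i))%MM)).
  apply: eq_big => [r|r _] /=; last by rewrite addmK.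
  apply/andP; split; first by rewrite mnmDE mnm1E eqxx addn1.
  by apply/eqP/val_inj; rewrite /= insubdK addmK //; apply: bmdeg.
move=> r ri0; apply/val_inj => /=.
by rewrite insubdK ?submK ?lep1mP //; apply: dn.
Qed.

(** * Monomials in x viewed as monomials in t and x *)

Section LiftMultinom.
Variable n : nat.
Implicit Types l r : 'X_{1..n}.

Definition xmnm l : 'X_{1..n.+1} :=
  [multinom oapp l 0%N (unlift ord0 j) | j < n.+1].

Lemma xmnm_tvar l : xmnm l (tvar n) = 0%N.
Proof. by rewrite mnmE unlift_none. Qed.

Lemma xmnm_xvar l i : xmnm l (xvar i) = l i.
Proof. by rewrite mnmE liftK. Qed.

Lemma xmnmD l r : xmnm (l + r)%MM = (xmnm l + xmnm r)%MM.
Proof.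
apply/mnmP => j; rewrite mnmDE !mnmE.
by case: unliftP => //= i _; rewrite mnmDE.
Qed.

Lemma xmnm0 : xmnm 0%MM = 0%MM.
Proof.
apply/mnmP => j; rewrite !mnmE.
by case: unliftP => //= i _; rewrite mnm0E.
Qed.

Lemma xmnmU i : xmnm U_(i)%MM = U_(xvar i)%MM.
Proof.
apply/mnmP => j; rewrite !mnmE; case: unliftP => [k ->|->] //=.
by rewrite mnm1E (inj_eq (@lift_inj _ ord0)).
Qed.

Lemma mdeg_xmnm l : mdeg (xmnm l) = mdeg l.
Proof.
rewrite !mdegE big_ord_recl xmnm_tvar add0n.
by apply: eq_bigr => i _; rewrite xmnm_xvar.
Qed.

Lemma xmnm_inj : injective xmnm.
Proof. by move=> l r /mnmP e; apply/mnmP => i; rewrite -!xmnm_xvar e. Qed.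

Lemma xmnmP (m : 'X_{1..n.+1}) : m (tvar n) = 0%N ->
  exists l, m = xmnm l.
Proof.
move=> m0; exists [multinom m (xvar i) | i < n].
apply/mnmP => j; rewrite mnmE; case: unliftP => [k ->|->] //=.
by rewrite mnmE.
Qed.

End LiftMultinom.

Lemma mderiv_sum (n : nat) (A : nzRingType) (I : Type) (s : seq I) (Q : pred I)
    (f : I -> {mpoly A[n]}) (i : 'I_n) :
  (\sum_(j <- s | Q j) f j)^`M(i) = \sum_(j <- s | Q j) (f j)^`M(i).
Proof. exact: linear_sum. Qed.

(** * The polynomials xi in characteristic zero and their differential equation *)

Section CharacteristicZero.
Variables (F : fieldType) (n : nat).
Hypothesis F0 : [pchar F] =i pred0.
Notation P := {mpoly F[n.+1]}.
Notation t := (tvar n).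
Notation T := ('X_t : P).

Let natr_neq0 k : (k%:R != 0 :> F) = (k != 0)%N.
Proof. by have /pcharf0P -> := F0. Qed.

Let factF k : k`!%:R != 0 :> F.
Proof. by rewrite natr_neq0 -lt0n fact_gt0. Qed.

(* Rewriting the product in [xi] as a quotient of factorials gives one formula
   for every coefficient, including the two leading ones: [xi_coef i r] is the
   coefficient of t^(i+1-r) in xi_(1,i+1). *)
Definition xi_coef (i r : nat) : F :=
  (-1) ^+ r * (i + r)`!%:R / (i.+1`! * (i - r)`! * r`!)%:R.

Lemma fact_prodD (i r : nat) :
  (i.+1`! * \prod_(1 <= s < r.+1) (i.+1 + s) = (i.+1 + r)`!)%N.
Proof.
elim: r => [|r IHr]; first by rewrite big_geq // muln1 addn0.
by rewrite big_nat_recr //= mulnA IHr addnS factS mulnC.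
Qed.

Lemma xiE (A : algType F) (i : nat) (x : A) :
  xi 1 i.+1 x = \sum_(0 <= r < i.+1) xi_coef i r *: x ^+ (i.+1 - r).
Proof.
case: i => [|i].
  by rewrite big_nat1 /xi /xi_coef subn0 !expr0 !mul1r.
(* The terms r = 0 and r = 1 match the two explicit leading terms of [xi]. *)
rewrite big_ltn // big_ltn // addrA /xi /xi_coef; congr (_ + _ + _).
- rewrite !subn0 expr1n mulr1 addn0 expr0 mul1r muln1 natrM invfM mulrCA.
  by rewrite divff ?mulr1.
- rewrite -scaleNr expr1n mulr1 subn1 addn1 subn2 !subn1 muln1 expr1 natrM.
  congr (_ *: _); have := factF i; have := factF i.+2.
  move: (i.+2`!%:R) (i`!%:R) => a b a0 b0.
  by field; rewrite a0 b0.
apply: eq_big_nat => r /andP[r2 ri].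
rewrite expr1n mulr1; congr (_ *: _); rewrite -!mulrA; congr (_ * _).
case: r r2 ri => // r _ ri.
have -> : (i.+2 - r.+1 - 1 = i.+1 - r.+1)%N by lia.
have -> : (i.+1 + r.+1 = i.+2 + r)%N by lia.
rewrite -fact_prodD.
move: (factF i.+2) (factF (i.+1 - r.+1)%N) (factF r.+1).
move: (i.+2`!) ((i.+1 - r.+1)`!) (r.+1`!) (\prod_(_ <= _ < _) _)%N.
move=> a b c d a0 b0 c0; rewrite !natrM.
by field; rewrite a0 b0 c0.
Qed.

(** This compares the coefficients of t^(i-r) in xi_(i+2)'' + xi_(i+2)' = xi_(i+1). The next two
    lemmas are the extreme cases: the leading power t^(i+1), which only the first derivative
    reaches, and the constant term. *)
Lemma xi_coefSn (i r : nat) : (r < i)%N ->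
  xi_coef i.+1 r.+1 * (i - r).+1%:R
    + xi_coef i.+1 r * ((i - r).+2%:R * (i - r).+1%:R)
  = xi_coef i r.+1.
Proof.
(* Writing i = r + 1 + d turns every truncated subtraction into a sum. *)
move=> /subnKC <-; move: (i - r.+1)%N => d; rewrite /xi_coef.
have -> : (r.+1 + d - r = d.+1)%N by lia.
have -> : ((r.+1 + d).+1 - r.+1 = d.+1)%N by lia.
have -> : ((r.+1 + d).+1 - r = d.+2)%N by lia.
have -> : (r.+1 + d - r.+1 = d)%N by lia.
have -> : ((r.+1 + d).+1 + r.+1 = (r.+1 + d + r).+2)%N by lia.
have -> : ((r.+1 + d).+1 + r = (r.+1 + d + r).+1)%N by lia.
have -> : (r.+1 + d + r.+1 = (r.+1 + d + r).+1)%N by lia.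
move: (factF (r.+1 + d)%N) (factF r) (factF d).
rewrite exprS (factS (r.+1 + d).+1) (factS (r.+1 + d + r).+1).
rewrite (factS d.+1) (factS d) (factS r) (factS (r.+1 + d)).
move: ((r.+1 + d)`!) (r`!) (d`!) ((r.+1 + d + r).+1`!).
move=> a b c f a0 b0 c0.
rewrite !natrM.
field.
by rewrite a0 b0 c0 !(nat1r, =^~ natrD) !natr_neq0.
Qed.

Lemma xi_coef0S (i : nat) : xi_coef i.+1 0 * i.+2%:R = xi_coef i 0.
Proof.
rewrite /xi_coef !subn0 !addn0 !expr0 !mul1r !muln1 (factS i.+1).
move: (factF i.+1) (factF i) (natr_neq0 i.+2).
move: (i.+1`!) (i`!) => a b a0 b0 c0; rewrite !natrM.
by field; rewrite a0 b0 !(nat1r, =^~ natrD) natr_neq0.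
Qed.

Lemma xi_coef_last (i : nat) : xi_coef i.+1 i * 2%:R + xi_coef i.+1 i.+1 = 0.
Proof.
rewrite /xi_coef exprS subnn subSnn addnS (factS (i.+1 + i)) (factS i) muln1.
move: (factF i.+2) (factF i).
move: (i.+2`!) (i`!) ((i.+1 + i)`!) => a b c a0 b0.
rewrite !natrM.
by field; rewrite a0 b0 nat1r natr_neq0.
Qed.

Lemma mderiv_tvarXn k : (T ^+ k)^`M(t) = k%:R *: T ^+ k.-1.
Proof.
rewrite mpolyXn mderivX mulmnE mnm1E eqxx mul1n; case: k => [|k] /=.
  by rewrite !scale0r.
by rewrite mulmSr addmK mpolyXn.
Qed.

Lemma mderiv_tvar_xi0 : (xi 1 0 T)^`M(t) = 0.
Proof. by rewrite /= -mpolyC1 mderivC. Qed.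

Lemma xi_ode k : (xi 1 k.+1 T)^`M(t)^`M(t) + (xi 1 k.+1 T)^`M(t) = xi 1 k T.
Proof.
have d1 : (xi 1 k.+1 T)^`M(t)
    = \sum_(0 <= r < k.+1) (xi_coef k r * (k.+1 - r)%:R) *: T ^+ (k - r).
  rewrite xiE mderiv_sum; apply: eq_big_nat => r /andP[_ rk] /=.
  by rewrite mderivZ mderiv_tvarXn scalerA subSn.
have d2 : (xi 1 k.+1 T)^`M(t)^`M(t)
    = \sum_(0 <= r < k) (xi_coef k r * ((k.+1 - r)%:R * (k - r)%:R)) *: T ^+ (k - r.+1).
  rewrite d1 mderiv_sum /= big_nat_recr //= mderivZ mderiv_tvarXn subnn.
  rewrite scale0r scaler0 addr0; apply: eq_big_nat => r /andP[_ rk] /=.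
  by rewrite mderivZ mderiv_tvarXn scalerA mulrA subnS.
rewrite d2 d1; case: k {d1 d2} => [|k].
  have xi_coef00 : xi_coef 0 0 = 1.
    by rewrite /xi_coef expr0 mul1r; apply/divff/oner_neq0.
  by rewrite big_geq // add0r big_nat1 subnn expr0 xi_coef00 mul1r scale1r.
(* The r-th term of the second derivative has the same power of t as the (r+1)-st term of the first;
   the leading term stays single and the last pair is the vanishing constant term. *)
rewrite xiE [X in _ + X]big_nat_recl // addrCA -big_split /=.
rewrite [LHS]addrC big_nat_recr //= [RHS]big_nat_recl //= addrC.
rewrite !subn0 xi_coef0S -scalerDl subSS subSnn.
have -> : (k.+2 - k = 2)%N by lia.
rewrite !mulr1 xi_coef_last scale0r addr0; congr (_ + _).
apply: eq_big_nat => r /andP[_ rk]; rewrite -scalerDl; congr (_ *: _).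
rewrite -[RHS]xi_coefSn // addrC; congr (_ * _%:R + _ * (_%:R * _%:R)); lia.
Qed.

(** * The wave operator on the terms of the proposed solutions *)

(** As a derivative of x^l, of order 2r_i in each x_i, it needs no case split on 2r_i <= l_i. *)
Definition dderiv_mon (l r : 'X_{1..n}) : P := 'X_[xmnm l]^`M[xmnm (r + r)%MM].

Lemma dderiv_monU l r i :
  dderiv_mon l (r + U_(i)) = (dderiv_mon l r)^`M(xvar i)^`M(xvar i).
Proof.
rewrite /dderiv_mon -!mderivmU1m -!mderivmDm !xmnmD !xmnmU.
by congr (_^`M[_]); apply/mnmP => j; rewrite !mnmDE; lia.
Qed.

Lemma mderiv_tvar_dderiv_mon l r : (dderiv_mon l r)^`M(t) = 0.
Proof.
rewrite /dderiv_mon mderivmX mderivZ mderivX mnmBE xmnm_tvar sub0n.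
by rewrite scale0r scaler0.
Qed.

Lemma mderiv_xvar_xi k i : (xi 1 k T)^`M(xvar i) = 0.
Proof.
case: k => [|k]; first by rewrite /= -mpolyC1 mderivC.
rewrite xiE mderiv_sum big1_seq // => r _.
by rewrite /= mderivZ mpolyXn mderivX mulmnE mnm1E mul0n scale0r scaler0.
Qed.

(** The factor (2r_i)! binom(l_i, 2r_i) is the falling factorial produced by differentiating
    x_i^(l_i) 2r_i times. *)
Lemma wave_termE l r :
  wave_term F l r = (multinomial r)%:R *: (xi 1 (mdeg r) T * dderiv_mon l r).
Proof.
rewrite /wave_term natrM -scalerA mdegE; congr (_ *: _).
rewrite /dderiv_mon mderivmX -scalerAr; congr (_%:R *: (_ * _)).
  rewrite [RHS]big_ord_recl xmnm_tvar xmnm_tvar ffact0n mul1n.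
  apply: eq_bigr => i _; rewrite !xmnm_xvar mnmDE addnn -mul2n mulnC bin_ffact //.
rewrite mpolyXE_id big_ord_recl mnmBE xmnm_tvar sub0n expr0 mul1r.
by apply: eq_bigr => i _; rewrite mnmBE !xmnm_xvar mnmDE mul2n addnn.
Qed.

Definition wave_op (u : P) : P :=
  u^`M(t)^`M(t) + u^`M(t) - \sum_(i < n) u^`M(xvar i)^`M(xvar i).

Lemma wave_solutionE (u : P) :
  @dissipative_wave_solutions F n u = (wave_op u = 0).
Proof. by []. Qed.

Lemma wave_op_is_linear : linear wave_op.
Proof.
move=> c u v; rewrite /wave_op !(mderivD, mderivZ).
under eq_bigr do rewrite !(mderivD, mderivZ).
by rewrite big_split /= -scaler_sumr !scalerDr scalerN; ring.
Qed.

HB.instance Definition _ := GRing.isLinear.Build F P P _ wave_op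
  wave_op_is_linear.

Lemma mderiv2_xvar_wave_term l r i :
  (wave_term F l r)^`M(xvar i)^`M(xvar i)
    = (multinomial r)%:R *: (xi 1 (mdeg r) T * dderiv_mon l (r + U_(i))).
Proof.
rewrite wave_termE !mderivZ dderiv_monU.
by do 2!rewrite mderivM mderiv_xvar_xi mul0r add0r.
Qed.

(** [xi_ode] lowers the index of xi by one, and the Pascal rule spreads the result over the
    predecessors r - U_i. Each summand depends on r - U_i alone, as [big_bmnm_shift] requires. *)
Lemma mderiv_tvar_wave_term l r :
  (wave_term F l r)^`M(t)^`M(t) + (wave_term F l r)^`M(t)
    = \sum_(i < n | (r i != 0)%N) (multinomial (r - U_(i))%MM)%:R
        *: (xi 1 (mdeg (r - U_(i))) T * dderiv_mon l (r - U_(i) + U_(i))).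
Proof.
rewrite wave_termE !mderivZ !mderivM mderiv_tvar_dderiv_mon mulr0 addr0.
rewrite mderivM mderiv_tvar_dderiv_mon mulr0 addr0 -scalerDr -mulrDl.
have [->|r0] := eqVneq r 0%MM.
  rewrite mdeg0 mderiv_tvar_xi0 linear0 addr0 mul0r scaler0.
  by rewrite big_pred0 // => i; rewrite mnm0E.
rewrite multinomial_pascal // natr_sum scaler_suml; apply: eq_bigr => i ri0.
by rewrite (mdeg_subU ri0) xi_ode submK // lep1mP.
Qed.

Lemma wave_pol_solution l : @dissipative_wave_solutions F n (wave_pol F l).
Proof.
rewrite /dissipative_wave_solutions /=.
(* Under the t-derivatives the sum is cut one degree higher, since the shift by U_i lowers the bound
   by one. *)
have {1 2}-> := @wave_polE F n l (mdeg l).+2 (leqnSn _).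
apply/eqP; rewrite subr_eq0; apply/eqP.
rewrite (mderiv_sum _ _ (fun r : 'X_{1..n < _} => wave_term F l r)).
rewrite (mderiv_sum _ _ (fun r : 'X_{1..n < _} => (wave_term F l r)^`M(t))).
rewrite -big_split /=.
under eq_bigr do rewrite mderiv_tvar_wave_term.
rewrite (exchange_big_dep xpredT) //=; apply: eq_bigr => i _.
rewrite (big_bmnm_shift _ i (fun r => (multinomial r)%:R
        *: (xi 1 (mdeg r) T * dderiv_mon l (r + U_(i))))).
rewrite /wave_pol.
rewrite (mderiv_sum _ _ (fun r : 'X_{1..n < _} => wave_term F l r)).
rewrite (mderiv_sum _ _ (fun r : 'X_{1..n < _} => (wave_term F l r)^`M(xvar i))).
 apply: eq_bigr => r _ /=.
by rewrite mderiv2_xvar_wave_term.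
Qed.

(** * Restriction to t = 0 *)

Lemma mcoeff_wave_pol l (m : 'X_{1..n.+1}) : m t = 0%N ->
  (wave_pol F l)@_m = (xmnm l == m)%:R.
Proof.
move=> m0; rewrite /wave_pol (bigD1 (bm0 : 'X_{1..n < (mdeg l).+1})) //=.
rewrite mcoeffD linear_sum big1 /= ?addr0 => [|r r0].
  rewrite wave_termE mdeg0 mul1r /dderiv_mon addm0 xmnm0 mderivm0m.
  rewrite mcoeffZ mcoeffX /multinomial.
  by rewrite !big1 ?divn1 ?mul1r // => i _; rewrite mnm0E.
have : mdeg r != 0%N by rewrite mdeg_eq0.
rewrite wave_termE; case: (mdeg r) => // k _.
rewrite xiE.
(* All powers of t in xi_(k+1) are positive, so a factor t comes out and the term has no t-free
   monomial. *)
under eq_big_nat => j /andP[_ jk] do rewrite subSn // exprSr scalerAl.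
rewrite -mulr_suml -mulrA [T * _]mulrC mulrA mcoeffZ.
rewrite memN_msupp_eq0 ?mulr0 // (perm_mem (msuppMX _ _)).
apply/negP => /mapP[m' _ e]; move: m0.
by rewrite e mnmDE mnm1E eqxx.
Qed.

(* Downward induction on total degree: the equation writes the coefficient at m
   in terms of coefficients of total degree mdeg m + 1. *)
Lemma wave_solution_eq0 (u : P) : @dissipative_wave_solutions F n u ->
  (forall m : 'X_{1..n.+1}, m t = 0%N -> u@_m = 0) -> u = 0.
Proof.
rewrite /dissipative_wave_solutions /= => sol_u u0; apply/mpolyP => m.
rewrite mcoeff0; have [d] : exists d, (msize u <= mdeg m + d)%N.
  by exists (msize u); apply: leq_addl.
elim: d m => [|d IHd] m.
  by rewrite addn0 => /msize_mdeg_ge/memN_msupp_eq0.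
move=> le_d; have [/u0//|mt0] := eqVneq (m t) 0%N.
have gt_eq0 (m' : 'X_{1..n.+1}) : (mdeg m < mdeg m')%N -> u@_m' = 0.
  by move=> lt_m; apply: IHd; lia.
(* At m - U_t, the derivative u_t contributes m_t times the coefficient of u at m, and m_t is
   nonzero in F; all second derivatives draw on degree [mdeg m] + 1. *)
have := congr1 (mcoeff (m - U_(t))) sol_u.
rewrite mcoeff0 mcoeffB mcoeffD !mcoeff_mderiv linear_sum /= submK ?lep1mP //.
rewrite gt_eq0 ?mdegD ?mdeg1 ?addn1 // !mul0rn add0r.
rewrite big1 => [|i _].
  rewrite subr0 mnmBE mnm1E eqxx subn1 prednK ?lt0n // -mulr_natr => /eqP.
  by rewrite mulf_eq0 (negPf (_ : _%:R != 0)) ?natr_neq0 // orbF => /eqP.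
rewrite !mcoeff_mderiv gt_eq0 ?mul0rn // !mdegD !mdeg1 (mdeg_subU mt0); lia.
Qed.

(** * Linear independence and spanning *)

(** The coefficient at x^l is 1 on the basis element of l and 0 on the others. *)
Lemma wave_pol_lin_indep :
  lin_indep [set wave_pol F l | l in [set: 'X_{1..n}]].
Proof.
move=> s c us sB sum0 v vs; have [l _ lv] := sB v vs.
have := congr1 (mcoeff (xmnm l)) sum0; rewrite mcoeff0 linear_sum /=.
rewrite (bigD1_seq v) //= big_seq_cond big1 => [|w /andP[ws wv]].
  by rewrite addr0 mcoeffZ -lv mcoeff_wave_pol ?xmnm_tvar // eqxx mulr1.
have [k _ kw] := sB w ws; rewrite mcoeffZ -kw mcoeff_wave_pol ?xmnm_tvar //.
rewrite (inj_eq (@xmnm_inj n)); case: eqP => [kl|_]; last by rewrite mulr0.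
by rewrite -kw -lv kl eqxx in wv.
Qed.

(** The difference of the two sides is a solution vanishing at t = 0. The bound [msize u] exceeds
    the degree of every monomial of u. *)
Lemma wave_solution_expand (u : P) : @dissipative_wave_solutions F n u ->
  u = \sum_(l : 'X_{1..n < msize u}) u@_(xmnm l) *: wave_pol F l.
Proof.
move=> sol_u; apply/eqP; rewrite -subr_eq0; apply/eqP.
apply: wave_solution_eq0 => [|m m0].
  rewrite wave_solutionE linearB linear_sum /= big1 => [|l _].
    by rewrite subr0 -wave_solutionE.
  have := wave_pol_solution l; rewrite linearZ /= wave_solutionE => ->.
  by rewrite scaler0.
have [l ->] := xmnmP m0; rewrite mcoeffB linear_sum /=.
have coefE (k : 'X_{1..n}) :
    (u@_(xmnm k) *: wave_pol F k)@_(xmnm l) = (k == l)%:R * u@_(xmnm l).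
  rewrite mcoeffZ mcoeff_wave_pol ?xmnm_tvar // (inj_eq (@xmnm_inj n)).
  by case: eqP => [->|_]; rewrite ?mulr1 ?mulr0 ?mul1r ?mul0r.
have [lt_l|ge_l] := ltnP (mdeg l) (msize u).
  rewrite (bigD1 (BMultinom lt_l)) //= coefE eqxx mul1r big1 ?addr0 ?subrr //.
  by move=> k; rewrite bmeqP coefE /= => /negPf ->; rewrite mul0r.
rewrite big1 ?subr0 => [|k _].
  by apply/memN_msupp_eq0/msize_mdeg_ge; rewrite mdeg_xmnm.
rewrite coefE; case: eqP => [kl|_]; last by rewrite mul0r.
by have := bmdeg k; rewrite kl ltnNge ge_l.
Qed.

(* The coefficient function of the combination must depend on the polynomial
   [wave_pol F l] only, so it reads l off the t-free part of its argument. *)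
Lemma wave_pol_lin_span :
  @dissipative_wave_solutions F n
    `<=` lin_span [set wave_pol F l | l in [set: 'X_{1..n}]].
Proof.
move=> u sol_u; pose ls := enum {: 'X_{1..n < msize u}}.
exists [seq wave_pol F (l : 'X_{1..n < msize u}) | l <- ls].
exists (fun v => \sum_(l : 'X_{1..n < msize u}) v@_(xmnm l) * u@_(xmnm l)).
split=> [v /mapP[l _ ->]|]; first by exists (l : 'X_{1..n}).
rewrite big_map big_enum /= {1}(wave_solution_expand sol_u).
apply: eq_bigr => l _; congr (_ *: _).
rewrite (bigD1 l) //= mcoeff_wave_pol ?xmnm_tvar // eqxx mul1r.
rewrite big1 ?addr0 // => k kl; rewrite mcoeff_wave_pol ?xmnm_tvar //.
by rewrite (inj_eq (@xmnm_inj n)) eq_sym -bmeqP (negPf kl) mul0r.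
Qed.

End CharacteristicZero.

Theorem theorem2p5 (R : realType) (S : {pred R[i]}) (F : subFieldType S)
    (n : nat) (hn : (0 < n)%N) :
  is_basis (@dissipative_wave_solutions F n)
           [set wave_pol F l | l in [set: 'X_{1..n}]].
Proof.
(* F inherits characteristic zero through its injective inclusion in [R[i]]. *)
have F0 : [pchar F] =i pred0.
  apply/pcharf0P => k.
  by rewrite -(inj_eq (@val_inj _ _ F)) rmorph_nat rmorph0 Num.Theory.pnatr_eq0.
split; [|exact: wave_pol_lin_indep|exact: wave_pol_lin_span].
by move=> _ [l _ <-]; apply: wave_pol_solution.
Qed.
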